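(* Let $X$ be an affine normal variety over $\mathbb{F}_q$ with function field $K=\mathbb{F}_q(X)$, and let $x_0\in X(\mathbb{F}_q)$. Let $f_1,\dots,f_m\in K[t]$ be monic separable polynomials whose coefficients are regular at $x_0$, and let $L_i$ be the splitting field of $f_i$ over $K$ (inside a fixed algebraic closure of $K$), $G_i=\mathrm{Gal}(L_i/K)$, and $L=L_1\cdots L_m$. Assume that $L_1,\dots,L_m$ are mutually linearly disjoint over $K$, and that each specialized polynomial $f_i(x_0)\in\mathbb{F}_q[t]$ has distinct roots in $\overline{\mathbb{F}_q}$. Let $R_i\subset L_i$ be the set of roots of $f_i$ and let $\bar R_{i,x_0}\subset\overline{\mathbb{F}_q}$ be the set of roots of $f_i(x_0)$. Then the action of $\sigma_q(\alpha)=\alpha^q$ (componentwise) on $\bar R_{1,x_0}\times\cdots\times\bar R_{m,x_0}$ is isomorphic to the action of $\mathrm{Frob}_{x_0}\in\mathrm{Gal}(L/K)$ on $R_1\times\cdots\times R_m$; that is, there is a bijection $R_1\times\cdots\times R_m\to\bar R_{1,x_0}\times\cdots\times\bar R_{m,x_0}$ intertwining the two actions. Explicitly, under the isomorphism $\mathrm{Gal}(L/K)\cong G_1\times\cdots\times G_m$, $\sigma\mapsto(\sigma|_{L_1},\dots,\sigma|_{L_m})$, one has $$\mathrm{Frob}_{x_0}=(\mathrm{Frob}_{x_0,1},\dots,\mathrm{Frob}_{x_0,m})\in G_1\times\cdots\times G_m,$$ and this element determines the simultaneous splitting type of $(f_1(x_0),\dots,f_m(x_0))$ over $\mathbb{F}_q$: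 for each $i$, the splitting type of $f_i(x_0)$ is the cycle type of $\mathrm{Frob}_{x_0,i}$ acting on $R_i$.
   Context: All varieties over $\mathbb{F}_q$ are assumed geometrically integral. For $f\in K[t]$ with coefficients regular at $x_0$, $f(x_0)\in\mathbb{F}_q[t]$ is obtained by evaluating the coefficients at $x_0$. A polynomial in $\mathbb{F}_q[t]$ has splitting type $(d_1,\dots,d_r)$ if it is a product of $r$ irreducible polynomials over $\mathbb{F}_q$ of degrees $d_1,\dots,d_r$. The fields $L_1,\dots,L_m$ are mutually linearly disjoint over $K$ if the natural map $L_1\otimes_K\cdots\otimes_K L_m\to L_1\cdots L_m$, $x_1\otimes\cdots\otimes x_m\mapsto x_1\cdots x_m$, is an isomorphism. Frobenius: let $\mathcal{O}$ be the integral closure in $L$ of the local ring $\mathcal{O}_{X,x_0}$, and let $\mathfrak{M}\subset\mathcal{O}$ be a maximal ideal lying over the maximal ideal of $\mathcal{O}_{X,x_0}$. Under the distinct-roots hypothesis the inertia group at $\mathfrak{M}$ is trivial, and there is a unique $\sigma\in\mathrm{Gal}(L/K)$ with $\sigma(a)\equiv a^q\pmod{\mathfrak{M}}$ for all $a\in\mathcal{O}$; $\mathrm{Frob}_{x_0}$ denotes this element (well defined up to conjugation as $\mathfrak{M}$ varies). $\mathrm{Frob}_{x_0,i}\in G_i$ is the analogous element for $L_i$, taken with respect to the maximal ideal $\mathfrak{M}\cap L_i$ of the integral closure of $\mathcal{O}_{X,x_0}$ in $L_i$. An element $(\sigma_1,\dots,\sigma_m)\in G_1\times\cdots\times G_m$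 acts on $R_1\times\cdots\times R_m$ componentwise. *)

(* Defs.v *)
From HB Require Import structures.
From mathcomp Require Import all_boot all_order all_fingroup all_algebra.
From mathcomp Require Import all_solvable all_field.
From mathcomp Require Import fraction ring_quotient.
From mathcomp Require Import mpoly.
From Stdlib Require Import ClassicalEpsilon.

Set Implicit Arguments.
Unset Strict Implicit.
Unset Printing Implicit Defensive.

Import GRing.Theory.
Local Open Scope ring_scope.

(* An affine variety X over F is given by its coordinate ring A with the
   structure map [c : F -> A]. *)
Section AffineVariety.

(* The ideal of k[x_1, ..., x_n] generated by the image of I. *)
Definition extended_ideal (F k : fieldType) (iota : {rmorphism F -> k})
    (n : nat) (I : {mpoly F[n]} -> Prop) (p : {mpoly k[n]}) : Prop :=
  exists s : seq ({mpoly k[n]} * {mpoly F[n]}),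
    (forall u, u \in s -> I u.2)
    /\ p = \sum_(u <- s) u.1 * map_mpoly iota u.2.

(* A = F[x_1, ..., x_n] / I with I = ker pi, and, for every field extension
   k of F, the ring A (x)_F k = k[x_1, ..., x_n] / I k[x_1, ..., x_n] is an
   integral domain. *)
Definition affine_geom_integral (F : fieldType) (A : idomainType)
    (c : {rmorphism F -> A}) : Prop :=
  exists (n : nat) (pi : {rmorphism {mpoly F[n]} -> A}),
    [/\ forall a : F, pi a%:MP = c a,
        forall b : A, exists p, pi p = b
      & forall (k : fieldType) (iota : {rmorphism F -> k}),
          let Ik := extended_ideal iota (fun p => pi p = 0) in
          ~ Ik 1 /\ forall p q, Ik (p * q) -> Ik p \/ Ik q].

Variable A : idomainType.
Notation K := {fraction A}.

(* The local ring of Spec A at P, as a subring of K. *)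
Definition local_ring (P : {pred A}) (z : K) : Prop :=
  exists a s : A, s \notin P /\ z = tofrac a / tofrac s.

Definition integral_over (S : K -> Prop) (E : algType K) (y : E) : Prop :=
  exists p : {poly K},
    [/\ p \is monic, forall j, S p`_j & root (map_poly (in_alg E) p) y].

Definition normal_variety : Prop :=
  forall P : {pred A}, idealr_closed P -> prime_idealr_closed P ->
  forall z : K, integral_over (local_ring P) (z : K^o) -> local_ring P z.

End AffineVariety.

(* A point of X(F) is an F-algebra morphism [x0 : A -> F], that is, a ring
   morphism with [cancel c x0]. *)
Section Specialization.

Variables (F : fieldType) (A : idomainType) (x0 : {rmorphism A -> F}).
Notation K := {fraction A}.

Definition regular_at : K -> Prop := local_ring [pred a | x0 a == 0].

Definition value_at (z : K) : F :=
  epsilon (inhabits 0) (fun v => exists a s : A,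
    [/\ x0 s != 0, z = tofrac a / tofrac s & v = x0 a / x0 s]).

Lemma value_atE (a s : A) :
  x0 s != 0 -> value_at (tofrac a / tofrac s) = x0 a / x0 s.
Proof.
move=> s0; rewrite /value_at; set Q := (fun v => _).
have [a' [s' [s'0 eqz ->]]] : Q (epsilon (inhabits 0) Q).
  by apply: epsilon_spec; exists (x0 a / x0 s), a, s.
have nz t : x0 t != 0 -> tofrac t != 0 :> K.
  by apply: contraNneq => /eqP; rewrite tofrac_eq0 => /eqP ->; rewrite rmorph0.
apply/eqP; rewrite eqr_div // -!rmorphM; apply/eqP; congr (x0 _).
move/eqP: eqz; rewrite GRing.eqr_div ?nz // -!rmorphM tofrac_eq => /eqP.
by [].
Qed.

Definition specialize (f : {poly K}) : {poly F} := map_poly value_at f.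

End Specialization.

Section Frobenius.

Variables (F : finFieldType) (A : idomainType) (x0 : {rmorphism A -> F}).
Notation K := {fraction A}.
(* E is any finite normal extension of K, playing the role of a sufficiently
   large piece of a fixed algebraic closure of K. *)
Variable E : splittingFieldType K.

Definition integral_closure (L : {subfield E}) (y : E) : Prop :=
  y \in L /\ integral_over (regular_at x0) y.

Definition is_ideal (S J : E -> Prop) : Prop :=
  [/\ forall y, J y -> S y, J 0, forall y z, J y -> J z -> J (y + z)
    & forall y z, S y -> J z -> J (y * z)].

Definition is_maximal_ideal (S M : E -> Prop) : Prop :=
  [/\ is_ideal S M, ~ M 1
    & forall J, is_ideal S J -> (forall y, M y -> J y) -> ~ J 1 ->
      forall y, J y -> M y].

Definition maximal_over_point (L : {subfield E}) (M : E -> Prop) : Prop :=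
  is_maximal_ideal (integral_closure L) M
  /\ forall z : K, regular_at x0 z -> (M z%:A <-> value_at x0 z = 0).

Definition Frobenius_congruence (L : {subfield E}) (M : E -> Prop)
    (s : gal_of L) : Prop :=
  s \in 'Gal(L / 1)%g
  /\ forall a, integral_closure L a -> M (s a - a ^+ #|F|).

Definition is_Frobenius (L : {subfield E}) (M : E -> Prop) (s : gal_of L) :
    Prop :=
  [/\ maximal_over_point L M, Frobenius_congruence M s
    & forall t : gal_of L, Frobenius_congruence M t -> t = s].

End Frobenius.

Section LinearDisjointness.

Variables (K : fieldType) (I : finType).

Definition multilinear (W : I -> lmodType K) (T : lmodType K)
    (mu : (forall i, W i) -> T) : Prop :=
  forall (x : forall i, W i) (i : I) (a : K) (u v : W i),
    mu (dfwith x (a *: u + v)) = a *: mu (dfwith x u) + mu (dfwith x v).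

Definition is_tensor_product (W : I -> lmodType K) (T : lmodType K)
    (tau : (forall i, W i) -> T) : Prop :=
  multilinear tau
  /\ forall (V : lmodType K) (mu : (forall i, W i) -> V), multilinear mu ->
     (exists g : {linear T -> V}, forall x, g (tau x) = mu x)
     /\ (forall g h : {linear T -> V},
           (forall x, g (tau x) = mu x) -> (forall x, h (tau x) = mu x) ->
           g =1 h).

Variables (E : fieldExtType K) (L_ : I -> {subfield E}).

Definition compositum : {subfield E} := <<\sum_i L_ i>>%AS.

(* [g] is the natural map from the tensor product T of the L_i. *)
Definition linearly_disjoint : Prop :=
  exists (T : lmodType K)
         (tau : (forall i, (subvs_of (L_ i) : lmodType K)) -> T)
         (g : {linear T -> E}),
    [/\ is_tensor_product tau,
        forall x, g (tau x) = \prod_i vsval (x i),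
        injective g
      & forall y, y \in compositum <-> exists t, g t = y].

End LinearDisjointness.

Definition distinct_roots (F Fbar : fieldType) (iota : {rmorphism F -> Fbar})
    (p : {poly F}) : Prop :=
  exists2 rs : seq Fbar, uniq rs
    & map_poly iota p = iota (lead_coef p) *: \prod_(r <- rs) ('X - r%:P).

Definition splitting_type (F : fieldType) (p : {poly F}) (ds : seq nat) :
    Prop :=
  exists ps : seq {poly F},
    [/\ forall u : {poly F}, u \in ps -> irreducible_poly u, p = \prod_(u <- ps) u
      & perm_eq ds [seq (size (u : {poly F})).-1 | u <- ps]].

(* [cs] lists the cycles of [f] on the finite set [R]. *)
Definition cycle_type (T : eqType) (f : T -> T) (R : {pred T}) (ds : seq nat) :
    Prop :=
  exists cs : seq (seq T),
    [/\ forall s : seq T, s \in cs -> s != [::] /\ fcycle f s, uniq (flatten cs),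
        flatten cs =i R & perm_eq ds [seq size s | s <- cs]].

Definition isomorphic_actions (T U : Type) (X : T -> Prop) (f : T -> T)
    (Y : U -> Prop) (g : U -> U) : Prop :=
  exists phi : T -> U,
    [/\ forall x, X x -> Y (phi x),
        forall x x', X x -> X x' -> phi x = phi x' -> x = x',
        forall y, Y y -> exists2 x, X x & phi x = y
      & forall x, X x -> phi (f x) = g (phi x)].

Definition roots_in (K : fieldType) (E : fieldExtType K) (L : {subfield E})
    (f : {poly K}) : {pred E} :=
  [pred y in L | root (map_poly (in_alg E) f) y].

(* Main.v *)
Require Import Defs.
From HB Require Import structures.
From mathcomp Require Import all_boot all_order all_fingroup all_algebra.
From mathcomp Require Import all_solvable all_field.
From mathcomp Require Import fraction ring_quotient generic_quotient.
From Stdlib Require Import ClassicalEpsilon.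

(* Let O' be the integral closure of the local ring O at x0 and q = #|F|.  For
   a in O'[X], the polynomial prod_s (T - s(a)) over the Galois group has
   coefficients in O by normality, so its reduction mod M has coefficients in F
   and is fixed by the q-power map on coefficients; hence the q-power of the
   reduction of a is again one of its roots, i.e., the reduction of some s(a).
   Choosing the coefficients of a to be counterexamples, one for each s, shows
   that some s is a Frobenius element.  Since s has finite order, O'/M is a
   finite field, so it is generated by one element and embeds in Fbar over F;
   reduction is then a Frobenius-equivariant bijection from the roots of f_i to
   those of f_i(x0), which yields uniqueness and the cycle types.  The map
   Gal(L/K) -> prod_i G_i is injective, and bijective by counting: linear
   disjointness makes the products of basis elements of the L_i free. *)

Set Implicit Arguments.
Unset Strict Implicit.
Unset Printing Implicit Defensive.

Import GRing.Theory.
Local Open Scope ring_scope.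

(** * Splitting types and cycle types over a finite field *)

(** The phantom argument [iota] records that [k] has the characteristic of [F], which is what makes
    the power map additive, so that it can carry a ring morphism structure. *)
Definition frobenius_power (F : finFieldType) (k : comNzRingType)
  (iota : {rmorphism F -> k}) (x : k) : k := x ^+ #|F|.

Section FrobeniusPower.

Variables (F : finFieldType) (k : comNzRingType) (iota : {rmorphism F -> k}).

Lemma pchar_nat_card : [pchar k].-nat #|F|.
Proof.
have [p p_pr pF] := finPcharP F.
have /and3P[pgF _ _] := fin_ring_pchar_abelem pF.
rewrite /pgroup cardsT in pgF; apply: sub_in_pnat pgF => r _ /eqP ->.
exact: (rmorph_pchar iota).
Qed.

Fact frobenius_power_zmod_morphism : zmod_morphism (frobenius_power iota).
Proof.
move=> x y; apply/(canRL (addrK _)); rewrite /frobenius_power.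
by rewrite -(exprDn_pchar _ _ pchar_nat_card) subrK.
Qed.

Fact frobenius_power_monoid_morphism : monoid_morphism (frobenius_power iota).
Proof. by split=> [|x y]; rewrite /frobenius_power ?expr1n ?exprMn. Qed.

HB.instance Definition _ := GRing.isZmodMorphism.Build k k
  (frobenius_power iota) frobenius_power_zmod_morphism.
HB.instance Definition _ := GRing.isMonoidMorphism.Build k k
  (frobenius_power iota) frobenius_power_monoid_morphism.

Lemma frobenius_power_rmorph (a : F) : frobenius_power iota (iota a) = iota a.
Proof. by rewrite /frobenius_power -rmorphXn expf_card. Qed.

End FrobeniusPower.

(** Over [F] the polynomial X^q - X is the product of the X - a, so its roots in [k] all come from
    [F]. *)
Lemma fixed_frobenius_power (F : finFieldType) (k : fieldType)
    (iota : {rmorphism F -> k}) (y : k) :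
  frobenius_power iota y = y -> exists a, y = iota a.
Proof.
move=> yq; have: root (map_poly iota ('X^#|F| - 'X)) y.
  rewrite /frobenius_power in yq.
  by rewrite rmorphB rmorphXn /= map_polyX rootE !hornerE yq subrr.
rewrite finField_genPoly rmorph_prod /=.
under eq_bigr do rewrite rmorphB /= map_polyX map_polyC.
rewrite -(big_map iota predT (fun a => 'X - a%:P)) root_prod_XsubC.
by case/mapP => a _ ->; exists a.
Qed.

Lemma poly_lift (R S : nzRingType) (v : {rmorphism R -> S}) (p : {poly S}) :
  (forall j, exists a, p`_j = v a) -> exists u, p = map_poly v u.
Proof.
move=> lift; pose a j := proj1_sig (constructive_indefinite_description _ (lift j)).
have aE j : p`_j = v (a j) by rewrite /a; case: constructive_indefinite_description.
exists (\poly_(j < size p) a j); apply/polyP => j.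
rewrite coef_map coef_poly /=; case: ltnP => [_|/(nth_default 0) ->] //.
by rewrite rmorph0.
Qed.

Lemma fixed_frobenius_poly (F : finFieldType) (k : fieldType)
    (iota : {rmorphism F -> k}) (p : {poly k}) :
  map_poly (frobenius_power iota) p = p -> exists u, p = map_poly iota u.
Proof.
move=> pq; apply: poly_lift => j; apply: (@fixed_frobenius_power F).
by rewrite -[in RHS]pq coef_map.
Qed.

Lemma fpath_map (T : eqType) (f : T -> T) x p :
  fpath f x p -> p = map f (belast x p).
Proof. by elim: p x => //= y p IHp x /andP[/eqP <- /IHp <-]. Qed.

Lemma fcycle_perm (T : eqType) (f : T -> T) s :
  fcycle f s -> perm_eq (map f s) s.
Proof.
case: s => // x p /fpath_map; rewrite belast_rcons => <-.
by rewrite perm_rcons.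
Qed.

Lemma fcycle_closed (T : eqType) (f : T -> T) (P : T -> Prop) s x :
    (forall y, P y -> P (f y)) -> fcycle f s -> x \in s -> P x ->
  {in s, forall y, P y}.
Proof.
move=> Pf + /rot_to[i s' def_s].
rewrite -(rot_cycle i) def_s /= => cyc Px y.
rewrite -(mem_rot i) def_s; move: cyc; rewrite rcons_path => /andP[+ _].
elim: s' {def_s} x Px => [|z s' IH] x Px /=; first by rewrite inE => _ /eqP->.
case/andP=> /eqP <- pth; rewrite inE => /orP[/eqP-> //|].
by apply: IH => //; apply: Pf.
Qed.

(** Used to transport cycle types between the roots of [f i] and those of its specialization. The
    listed cycles stay inside [R], so injectivity and equivariance of [h] on [R] suffice. *)
Lemma cycle_type_map (T U : eqType) (f : T -> T) (g : U -> U) (h : T -> U)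
    (R : {pred T}) (R' : {pred U}) ds :
    {in R &, injective h} -> (forall y, (y \in R') <-> exists2 x, x \in R & y = h x) ->
    {in R, forall x, h (f x) = g (h x)} ->
  cycle_type f R ds -> cycle_type g R' ds.
Proof.
move=> h_inj hR hfg [cs [ccs ucs mcs dcs]]; exists (map (map h) cs).
have sub s : s \in cs -> {subset s <= R}.
  by move=> scs x xs; rewrite -mcs; apply/flattenP; exists s.
split.
- move=> _ /mapP[s scs ->]; have [s0 cyc] := ccs s scs; split.
    by rewrite -size_eq0 size_map size_eq0.
  apply: (homo_cycle_in (P := R) (e := frel f)) cyc; last exact/allP/sub.
  by move=> x y xR _ /= /eqP <-; rewrite hfg.
- by rewrite -map_flatten map_inj_in_uniq //; apply: sub_in2 h_inj => x; rewrite mcs.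
- move=> y; rewrite -map_flatten; apply/mapP/idP => [[x]|/hR[x xR ->]].
    by rewrite mcs => xR ->; apply/hR; exists x.
  by exists x; rewrite ?mcs.
- by rewrite -map_comp; under eq_map do rewrite /= size_map.
Qed.

Lemma root_frobenius_power (F : finFieldType) (k : fieldType)
    (iota : {rmorphism F -> k}) (p : {poly F}) (z : k) :
  root (map_poly iota p) z -> root (map_poly iota p) (frobenius_power iota z).
Proof.
move/(rmorph_root (frobenius_power iota)).
congr (root _ _); apply/polyP => j.
by rewrite !coef_map /= frobenius_power_rmorph.
Qed.

(** Frobenius permutes the factors X - r, so the product descends to [F]. A nonconstant factor over
    [F] has a root in [s], and its roots are stable under Frobenius, so it vanishes on the whole
    cycle. *)
Lemma frobenius_cycle_polynomial (F : finFieldType) (k : fieldType)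
    (iota : {rmorphism F -> k}) (s : seq k) :
    s != [::] -> uniq s -> fcycle (frobenius_power iota) s ->
  exists u : {poly F}, irreducible_poly u
    /\ map_poly iota u = \prod_(r <- s) ('X - r%:P).
Proof.
move=> s0 us cyc.
have [|u uE] := @fixed_frobenius_poly F k iota (\prod_(r <- s) ('X - r%:P)).
  rewrite rmorph_prod /=; under eq_bigr do rewrite rmorphB /= map_polyX map_polyC.
  rewrite -(big_map (frobenius_power iota) predT (fun r => 'X - r%:P)) /=.
  exact/perm_big/fcycle_perm.
have su : size u = (size s).+1.
  by rewrite -(size_map_poly iota) -uE size_prod_XsubC.
exists u; split=> //; split=> [|w w1 wu]; first by rewrite su ltnS lt0n size_eq0.
have u0 : u != 0 by rewrite -size_poly_gt0 su.
have w0 : w != 0 by apply: contraTneq wu => ->; rewrite dvd0p.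
have: map_poly iota w %| \prod_(r <- s) ('X - r%:P) by rewrite uE dvdp_map.
case/dvdp_prod_XsubC => mk wE.
have smk : size (mask mk s) != 0%N.
  apply: contraNneq w1 => smk; rewrite -(size_map_poly iota) (eqp_size wE).
  by rewrite size_prod_XsubC smk.
have [r rmk]: exists r, r \in mask mk s.
  by case: (mask mk s) smk => // r ? _; exists r; rewrite inE eqxx.
have rw : root (map_poly iota w) r by rewrite (eqp_root wE) root_prod_XsubC.
have all_w : {in s, forall y, root (map_poly iota w) y}.
  apply: fcycle_closed cyc (mem_mask rmk) rw => y.
  exact: root_frobenius_power.
rewrite /eqp wu -(dvdp_map iota) -uE uniq_roots_dvdp ?uniq_rootsE //.
exact/allP.
Qed.

Lemma inj_iter (T : Type) (f : T -> T) n : injective f -> injective (iter n f).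
Proof. by move=> f_inj; elim: n => //= n IHn x y /f_inj/IHn. Qed.

Lemma iter_cycle (T : eqType) (f : T -> T) (z : T) (d : nat) :
    injective f -> (0 < d)%N -> iter d f z = z ->
  exists s : seq _, [/\ z \in s, s != [::], uniq s & fcycle f s].
Proof.
move=> f_inj d0 fd; have ex_d : exists d, (0 < d)%N && (iter d f z == z).
  by exists d; rewrite d0 fd eqxx.
case: (ex_minnP ex_d) => -[|e] // /andP[_ /eqP fe] min_e.
exists (traject f z e.+1); split=> //; first by rewrite inE eqxx.
(* A repetition at index [i] would, after cancelling [i] iterates, give the period [e - i], smaller
   than the least period [e.+1]. *)
- rewrite looping_uniq; apply/trajectP => -[i lt_ie fei].
  have: iter (e - i) f z = z.
    apply: (inj_iter (n := i) f_inj); rewrite -iterD subnKC //; exact: ltnW.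
  move/eqP => fi; have := min_e (e - i)%N; rewrite subn_gt0 lt_ie fi => /(_ isT).
  by rewrite leqNgt ltnS leq_subr.
- rewrite /= -[z in rcons _ z]fe iterSr.
  rewrite -[iter e f _]/(iter e f (f z)) -trajectSr.
  exact: fpath_traject.
Qed.

(** The field [k] may be infinite, but all iterates of [z] are roots of [p], so [size p] of them
    cannot be distinct. Injectivity of Frobenius turns a repetition into a return to [z]. *)
Lemma frobenius_orbit (F : finFieldType) (k : fieldType)
    (iota : {rmorphism F -> k}) (p : {poly F}) (z : k) :
    p != 0 -> root (map_poly iota p) z ->
  exists s : seq _, [/\ z \in s, s != [::], uniq s & fcycle (frobenius_power iota) s].
Proof.
move=> p0 pz; set f := frobenius_power iota.
have : ~~ uniq (traject f z (size p)).
  apply/negP => up; suff: (size (traject f z (size p)) < size (map_poly iota p))%N.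
    by rewrite size_traject size_map_poly ltnn.
  apply: max_poly_roots; rewrite ?map_poly_eq0 //.
  by apply/allP => y /trajectP[i _ ->]; elim: i => //= i /root_frobenius_power.
have: (0 < size p)%N by rewrite size_poly_gt0.
case: (size p) => // n _; rewrite looping_uniq negbK => /trajectP[i lt_in fn].
apply: (@iter_cycle _ f z (n - i)); rewrite ?subn_gt0 //; first exact: fmorph_inj.
apply: (inj_iter (n := i) (@fmorph_inj _ _ f)).
by rewrite -iterD subnKC //; exact: ltnW.
Qed.

(** An irreducible factor has as its roots the Frobenius cycle of any one of them, and each cycle
    yields an irreducible polynomial. Degrees thereby become cycle lengths. *)
Lemma splitting_type_cycle_type (F : finFieldType) (k : fieldType)
    (iota : {rmorphism F -> k}) (p : {poly F}) (rs : seq k) ds :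
    uniq rs -> map_poly iota p = \prod_(r <- rs) ('X - r%:P) ->
  splitting_type p ds <-> cycle_type (frobenius_power iota) [in rs] ds.
Proof.
move=> urs pE; have p_mon : p \is monic.
  by rewrite -(map_monic iota) pE monic_prod_XsubC.
split=> [[ps [irr_ps def_p dsE]]|[cs [ccs ucs mcs dsE]]].
- have cyc_of u : u \in ps -> exists s : seq k,
      [/\ s != [::], uniq s, fcycle (frobenius_power iota) s
        & map_poly iota u %= \prod_(r <- s) ('X - r%:P)].
    move=> ups; have [u1 irr_u] := irr_ps _ ups.
    have: map_poly iota u %| \prod_(r <- rs) ('X - r%:P).
      by rewrite -pE dvdp_map def_p (big_rem u ups) dvdp_mulr.
    case/dvdp_prod_XsubC => mk uE.
    have [z zmk]: exists z, z \in mask mk rs.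
      have: size (mask mk rs) != 0%N.
        apply: contraTneq u1 => smk; rewrite -leqNgt -(size_map_poly iota).
        by rewrite (eqp_size uE) size_prod_XsubC smk.
      by case: (mask mk rs) => // r ? _; exists r; rewrite inE eqxx.
    have uz : root (map_poly iota u) z by rewrite (eqp_root uE) root_prod_XsubC.
    have [s [zs s0 us cyc]] := frobenius_orbit (irredp_neq0 (irr_ps _ ups)) uz.
    exists s; split=> //.
    (* The cycle polynomial [w] divides [u], since [u] vanishes on all of [s]; irreducibility of [u]
       makes the two associate. *)
    have [w [[w1 irr_w] wE]] := frobenius_cycle_polynomial s0 us cyc.
    rewrite -wE eqp_map eqp_sym; apply: irr_u; first by rewrite neq_ltn w1 orbT.
    rewrite -(dvdp_map iota) wE uniq_roots_dvdp ?uniq_rootsE //.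
    apply/allP; apply: (fcycle_closed _ cyc zs uz) => y; exact: root_frobenius_power.
  pose s_ u : seq k := epsilon (inhabits [::]) (fun s =>
    [/\ s != [::], uniq s, fcycle (frobenius_power iota) s
        & map_poly iota u %= \prod_(r <- s) ('X - r%:P)]).
  have sP u (ups : u \in ps) := epsilon_spec (inhabits [::]) _ (cyc_of u ups).
  (* Both lists are the roots of the image of [p], counted with multiplicity. As [rs] has no
     repetition, the chosen cycles are disjoint. *)
  have perm_rs : perm_eq (flatten (map s_ ps)) rs.
    apply: prod_XsubC_eq; apply/eqP.
    rewrite -eqp_monic ?monic_prod_XsubC // -pE def_p rmorph_prod.
    rewrite big_flatten big_map /=.
    rewrite !big_seq; apply: (big_ind2 (fun x y => x %= y)) => [|x1 x2 y1 y2|].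
    + exact: eqpxx.
    + by move=> e1 e2; apply: eqp_trans (eqp_mulr _ e1) (eqp_mull _ e2).
    + by move=> u ups; rewrite eqp_sym; have [_ _ _] := sP u ups.
  exists (map s_ ps); split.
  + by move=> _ /mapP[u ups ->]; case: (sP u ups).
  + by rewrite (perm_uniq perm_rs).
  + by move=> z; rewrite (perm_mem perm_rs).
  + have <-: [seq (size (u : {poly F})).-1 | u <- ps] = map size (map s_ ps).
      rewrite -map_comp; apply/eq_in_map => u ups /=; have [_ _ _] := sP u ups.
      by move/eqp_size; rewrite size_map_poly size_prod_XsubC => ->.
    exact: dsE.
- have poly_of s : s \in cs -> exists u : {poly F}, irreducible_poly u
      /\ map_poly iota u = \prod_(r <- s) ('X - r%:P).
    move=> scs; have [s0 cyc] := ccs s scs.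
    apply: frobenius_cycle_polynomial => //.
    move: ucs; rewrite (perm_uniq (perm_flatten (perm_to_rem scs))) /= cat_uniq.
    by case/andP.
  pose u_ s := epsilon (inhabits 0) (fun u : {poly F} => irreducible_poly u
      /\ map_poly iota u = \prod_(r <- s) ('X - r%:P)).
  have uP s (scs : s \in cs) := epsilon_spec (inhabits 0) _ (poly_of s scs).
  exists (map u_ cs); split.
  + by move=> _ /mapP[s scs ->]; have [] := uP s scs.
  + apply: (map_poly_inj iota); rewrite pE big_map rmorph_prod /=.
    have perm_rs : perm_eq rs (flatten cs).
      by apply: uniq_perm => // z; rewrite mcs.
    rewrite (perm_big _ perm_rs) big_flatten /=.
    by rewrite !big_seq; apply: eq_bigr => s scs; have [_ ->] := uP s scs.
  + rewrite -map_comp (perm_trans dsE) //.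
    have: map size cs = map ((fun u : {poly F} => (size u).-1) \o u_) cs.
      apply/eq_in_map => s scs /=; have [_ uE] := uP s scs.
      by rewrite -(size_map_poly iota) uE size_prod_XsubC.
    by move=> ->.
Qed.

(** * Subrings and residue fields *)

Section SubringType.

Variables (R : fieldType) (S : subringClosed R).

Record subring := Subring { subring_val : R; _ : subring_val \in S }.

HB.instance Definition _ := [isSub for subring_val].
HB.instance Definition _ := [Choice of subring by <:].
HB.instance Definition _ := [SubChoice_isSubComNzRing of subring by <:].

End SubringType.

(** Local rings and integral closures are [Prop]-valued predicates on a field. Excluded middle makes
    them boolean, so that they can be turned into a ring [D] with an embedding [v]. *)
Lemma subring_type (R : fieldType) (S : R -> Prop) :
    S 1 -> (forall x y, S x -> S y -> S (x - y)) ->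
    (forall x y, S x -> S y -> S (x * y)) ->
  exists (D : comNzRingType) (v : {rmorphism D -> R}),
    injective v /\ forall y, S y <-> exists d, v d = y.
Proof.
move=> S1 SB SM.
pose b : {pred R} := fun y => if excluded_middle_informative (S y) then true else false.
have bP y : reflect (S y) (y \in b).
  by rewrite unfold_in; case: excluded_middle_informative => ?; constructor.
have b_closed : subring_closed b.
  by split=> [|x y /bP ? /bP ?|x y /bP ? /bP ?]; apply/bP; auto.
pose bC := GRing.isSubringClosed.Build R b b_closed.
pose B : subringClosed R := HB.pack b bC.
exists (subring B), val; split; first exact: val_inj.
move=> y; split=> [/bP yB|[d <-]]; first by exists (Subring (yB : y \in B)).
exact/bP/valP.
Qed.

Lemma lift_rmorphism (R : nzRingType) (D : nzRingType) (k : nzRingType)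
    (v : {rmorphism D -> k}) (h : {rmorphism R -> k}) :
    injective v -> (forall a, exists d, v d = h a) ->
  exists h' : {rmorphism R -> D}, forall a, v (h' a) = h a.
Proof.
move=> v_inj vh.
pose h' a := proj1_sig (constructive_indefinite_description _ (vh a)).
have h'E a : v (h' a) = h a by rewrite /h'; case: constructive_indefinite_description.
have h'B : zmod_morphism h'.
  by move=> x y; apply: v_inj; rewrite rmorphB /= !h'E rmorphB.
have h'M : monoid_morphism h'.
  by split=> [|x y]; apply: v_inj; rewrite ?rmorph1 ?rmorphM /= !h'E ?rmorph1 ?rmorphM.
pose h1 := GRing.isZmodMorphism.Build R D h' h'B.
pose h2 := GRing.isMonoidMorphism.Build R D h' h'M.
by exists (HB.pack h' h1 h2 : {rmorphism R -> D}).
Qed.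

Section QuotientField.

Variables (D : comNzRingType) (I : idealr D).
(** Maximality of [I] in elementwise form. *)
Hypothesis inv_mod : forall y, y \notin I -> exists u, u * y - 1 \in I.

Local Notation Q := {ideal_quot I}.
Local Notation piQ := (\pi_Q : D -> Q)%qT.

Fact pi_quot_eq0 (y : D) : (piQ y == 0) = (y \in I).
Proof. by rewrite piE Quotient.equivE subr0. Qed.

Fact quot_inv_ex (x : Q) : exists y : Q, (x != 0 -> y * x = 1) /\ (x = 0 -> y = 0).
Proof.
elim/quotW: x => x.
have [xI|/inv_mod[u uI]] := boolP (x \in I).
  have /eqP -> : piQ x == 0 by rewrite pi_quot_eq0.
  by exists 0; rewrite eqxx.
exists (piQ u); split=> [_|/eqP]; last first.
  rewrite pi_quot_eq0 => xI.
  suff: 1 \in I by rewrite idealr1.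
  by rewrite -[1](subKr (u * x)) rpredB // idealMr.
apply/eqP; rewrite -subr_eq0 -pi_quot_eq0 in uI *.
by rewrite rmorphB rmorphM rmorph1 in uI.
Qed.

Lemma quotient_field : exists (k : fieldType) (red : {rmorphism D -> k}),
  forall y, (red y == 0) = (y \in I).
Proof.
pose inv x := proj1_sig (constructive_indefinite_description _ (quot_inv_ex x)).
have invP x : (x != 0 -> inv x * x = 1) /\ (x = 0 -> inv x = 0).
  by rewrite /inv; case: constructive_indefinite_description.
pose fQ := GRing.ComNzRing_isField.Build Q (fun x => (invP x).1) ((invP 0).2 erefl).
pose k : fieldType := HB.pack Q fQ.
pose red : {rmorphism D -> k} := HB.pack_for {rmorphism D -> k} piQ
  (GRing.isZmodMorphism.Build D k piQ (rmorphB piQ))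
  (GRing.isMonoidMorphism.Build D k piQ (rmorph1 piQ, rmorphM piQ)).
by exists k, red; exact: pi_quot_eq0.
Qed.

End QuotientField.

(** * Embedding a finite residue field into an algebraically closed field *)

Lemma bounded_enum (T : eqType) (P : T -> Prop) n :
    (forall s : seq T, uniq s -> {in s, forall x, P x} -> (size s <= n)%N) ->
  exists s : seq T, uniq s /\ forall x, x \in s <-> P x.
Proof.
move=> bound.
(* Either an enumeration is reached, or a duplicate-free list in [P] can be lengthened once more; at
   [n.+1] the bound excludes the second case. *)
have grow m : (exists s : seq T, uniq s /\ forall x, x \in s <-> P x)
    \/ exists s : seq T, [/\ uniq s, {in s, forall x, P x} & size s = m].
  elim: m => [|m [enum|[s [us Ps sz]]]]; [by right; exists [::]|by left|].
  have [all_s|] := classic (forall x, P x -> x \in s).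
    by left; exists s; split=> // x; split; auto.
  move=> nall; have [x nx] := not_all_ex_not _ _ nall.
  have [Px xs0] := imply_to_and _ _ nx; move/negP: xs0 => xs.
  right; exists (x :: s); rewrite /= xs us sz; split=> // y.
  by rewrite inE => /predU1P[->|/Ps].
have [//|[s [us Ps sz]]] := grow n.+1.
by have := bound s us Ps; rewrite sz ltnn.
Qed.

(** [P] describes a subgroup of the multiplicative group of a field. It is finite, as it consists of
    roots of X^N - 1, and therefore cyclic. *)
Lemma primitive_generator (k : fieldType) (P : k -> Prop) (N : nat) :
    P 1 -> (forall x y, P x -> P y -> P (x * y)) ->
    (forall x, P x -> x != 0) -> (0 < N)%N -> (forall x, P x -> x ^+ N = 1) ->
  exists2 z, P z & forall x, P x -> exists i, x = z ^+ i.
Proof.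
move=> P1 PM Pn0 N_gt0 PN.
have [|s [us sP]] := @bounded_enum k P N.
  move=> s us Ps; rewrite -ltnS -(size_XnsubC (1 : k) N_gt0).
  apply: max_poly_roots us; first by rewrite -size_poly_gt0 size_XnsubC.
  by apply/allP => x /Ps/PN xN; rewrite rootE !hornerE xN subrr.
(* Multiplication by [x] permutes [s]; comparing the products over [s] and cancelling gives the
   exponent [size s], which matches the number of roots available to [has_prim_root]. *)
have sx1 x : P x -> x ^+ size s = 1.
  move=> Px; have: perm_eq (map ( *%R x) s) s.
    have um : uniq (map ( *%R x) s).
      by rewrite map_inj_uniq //; apply: mulfI; apply: Pn0.
    have [|| _ /(uniq_perm um us)//] := uniq_min_size um (s2 := s).
      by move=> _ /mapP[y /sP Py ->]; apply/sP/PM.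
    by rewrite size_map.
  move=> pe; have := perm_big s pe (op := *%R) (x := 1) (P := predT) (F := id).
  rewrite big_map big_split /= big_const_seq count_predT iter_mulr_1 => /eqP.
  rewrite -subr_eq0 -{2}[\prod_(_ <- _) _]mul1r -mulrBl mulf_eq0 subr_eq0.
  case/orP=> [/eqP //|].
  by rewrite prodf_seq_eq0 => /hasP[y /sP/Pn0/negPf ->].
have s_gt0 : (0 < size s)%N.
  by rewrite lt0n size_eq0; apply/eqP => s0; have := (sP 1).2 P1; rewrite s0.
have /hasP[z zs z_prim]: has (size s).-primitive_root s.
  apply: has_prim_root => //; apply/allP => x /sP/sx1 xs.
  by apply/unity_rootP.
exists z; first exact/sP.
by move=> x /sx1/(prim_rootP z_prim)[i ->]; exists i.
Qed.

Lemma irreducible_root_dvdp (F k : fieldType) (iota : {rmorphism F -> k})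
    (g p : {poly F}) (z : k) :
    irreducible_poly g -> root (map_poly iota g) z ->
  root (map_poly iota p) z = (g %| p).
Proof.
move=> irr_g gz; apply/idP/idP => [pz|/dvdpP[w ->]]; last first.
  by rewrite rmorphM rootM gz orbT.
apply: contraLR pz; rewrite -(irreducible_poly_coprime _ irr_g).
by rewrite -(coprimep_map iota) => /coprimep_root/(_ gz).
Qed.

(** Descent on the size: by [subfx_irreducibleP], if [p] is not irreducible then a smaller nonzero
    polynomial also vanishes at [z]. *)
Lemma irreducible_root_ex (F k : fieldType) (iota : {rmorphism F -> k})
    (p : {poly F}) (z : k) :
    p != 0 -> root (map_poly iota p) z ->
  exists2 g, irreducible_poly g & root (map_poly iota g) z.
Proof.
move: {2}(size p) (leqnn (size p)) => n; elim: n p => [|n IHn] p sp p0 pz.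
  by move: sp; rewrite leqn0 size_poly_eq0 (negPf p0).
have [|nirr] := classic (irreducible_poly p); first by exists p.
have [q [qz q0 sq]]: exists q,
    [/\ root (map_poly iota q) z, q != 0 & (size q < size p)%N].
  apply: NNPP => no_q; apply: nirr; apply/(subfx_irreducibleP pz p0) => q qz q0.
  by rewrite leqNgt; apply/negP => sq; apply: no_q; exists q.
by apply: IHn qz; rewrite // -ltnS (leq_trans sq).
Qed.

(** The elements of the image of [red] satisfy x^N = x, so the nonzero ones are powers of a single
    [red t]. Sending [red t] to a root in [Fbar] of its irreducible polynomial over [F] defines the
    embedding. *)
Lemma residue_embedding (F k Fbar : fieldType) (D : comNzRingType)
    (iota : {rmorphism F -> Fbar}) (c : {rmorphism F -> D})
    (red : {rmorphism D -> k}) (N : nat) :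
    (forall p : {poly Fbar}, size p != 1 -> exists x, root p x) ->
    (1 < N)%N -> (forall d, red d ^+ N = red d) ->
  exists red' : {rmorphism D -> Fbar},
    (forall d, (red' d == 0) = (red d == 0)) /\ forall a, red' (c a) = iota a.
Proof.
move=> Fbar_closed N_gt1 redN; pose j : {rmorphism F -> k} := red \o c.
have [] := @primitive_generator k (fun x => x != 0 /\ exists d, x = red d) N.-1.
- by split; [exact: oner_neq0|exists 1; rewrite rmorph1].
- move=> x1 y1 [x0 [x x1E]] [y0 [y y1E]]; split.
    by rewrite mulf_neq0.
  by exists (x * y); rewrite rmorphM x1E y1E.
- by move=> x [].
- by rewrite -ltnS prednK //; apply: ltn_trans N_gt1.
- move=> x1 [x0 [x x1E]]; rewrite x1E in x0 *; apply: (mulfI x0).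
  by rewrite mulr1 -exprS prednK ?redN //; apply: ltn_trans N_gt1.
move=> _ [_ [t ->]] gen_t.
have [g irr_g gt]: exists2 g, irreducible_poly g & root (map_poly j g) (red t).
  apply: (@irreducible_root_ex _ _ _ ('X^N - 'X)).
    by rewrite -size_poly_gt0 size_polyDl ?size_polyN ?size_polyX ?size_polyXn.
  by rewrite rmorphB rmorphXn /= map_polyX rootE !hornerE redN subrr.
have [zeta gzeta]: exists zeta, root (map_poly iota g) zeta.
  by apply: Fbar_closed; rewrite size_map_poly neq_ltn irr_g.1 orbT.
pose ev p := (map_poly j p).[red t]; pose ev' p := (map_poly iota p).[zeta].
(* Both evaluations vanish exactly on the multiples of [g]; hence [red'] will not depend on the
   polynomial chosen to represent [red d]. *)
have ev_eq p q : (ev p == ev q) = (ev' p == ev' q).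
  rewrite -subr_eq0 -[RHS]subr_eq0 -!hornerN -!hornerD -!rmorphB /= -!rootE.
  by rewrite (irreducible_root_dvdp _ irr_g gt) (irreducible_root_dvdp _ irr_g gzeta).
have lift d : exists p, red d = ev p.
  have [->|d0] := eqVneq (red d) 0; first by exists 0; rewrite /ev rmorph0 horner0.
  have [|i ->] := gen_t (red d); first by split=> //; exists d.
  by exists 'X^i; rewrite /ev map_polyXn !hornerE.
pose P d := proj1_sig (constructive_indefinite_description _ (lift d)).
have PE d : red d = ev (P d) by rewrite /P; case: constructive_indefinite_description.
pose red' d := ev' (P d).
have red'E d p : red d = ev p -> red' d = ev' p.
  by move=> dp; apply/eqP; rewrite -ev_eq -PE dp.
have red'B : zmod_morphism red'.
  move=> x y; rewrite (red'E _ (P x - P y)).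
    by rewrite /ev' rmorphB /= hornerD hornerN.
  by rewrite rmorphB /= (PE x) (PE y) /ev rmorphB /= hornerD hornerN.
have red'M : monoid_morphism red'.
  split=> [|x y].
    by rewrite (red'E _ 1) /ev /ev' !rmorph1 !hornerC.
  rewrite (red'E _ (P x * P y)).
    by rewrite /ev' rmorphM /= hornerM.
  by rewrite rmorphM /= (PE x) (PE y) /ev rmorphM /= hornerM.
exists (HB.pack_for {rmorphism D -> Fbar} red'
  (GRing.isZmodMorphism.Build D Fbar red' red'B)
  (GRing.isMonoidMorphism.Build D Fbar red' red'M)); split=> [d|a] /=.
  have := ev_eq (P d) 0; rewrite -PE /ev /ev' !rmorph0 !horner0 => ->.
  by [].
by rewrite (red'E _ a%:P) /ev /ev' ?map_polyC ?hornerC.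
Qed.

(** * The local ring at a rational point *)

Section LocalRing.

Variables (F : finFieldType) (A : idomainType) (x0 : {rmorphism A -> F}).
Local Notation K := {fraction A}.

Lemma tofrac_neq0 (s : A) : x0 s != 0 -> tofrac s != 0 :> K.
Proof.
by apply: contraNneq => /eqP; rewrite tofrac_eq0 => /eqP ->; rewrite rmorph0.
Qed.

Lemma regular_atP (z : K) :
  regular_at x0 z <-> exists a s : A, x0 s != 0 /\ z = tofrac a / tofrac s.
Proof. by []. Qed.

Lemma regular_at_tofrac (a : A) : regular_at x0 (tofrac a).
Proof. by apply/regular_atP; exists a, 1; rewrite !rmorph1 oner_neq0 divr1. Qed.

Lemma value_at_tofrac (a : A) : value_at x0 (tofrac a) = x0 a.
Proof.
have := @value_atE F A x0 a 1; rewrite !rmorph1 !divr1; apply; exact: oner_neq0.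
Qed.

Lemma regular_atB (y z : K) :
  regular_at x0 y -> regular_at x0 z -> regular_at x0 (y - z).
Proof.
case/regular_atP=> a [s [s0 ->]] /regular_atP[b [t [t0 ->]]]; apply/regular_atP.
exists (a * t - b * s), (s * t); rewrite !rmorphM mulf_neq0 //; split=> //.
by rewrite -[X in _ + X]mulNr addf_div ?tofrac_neq0 // rmorphB !rmorphM mulNr.
Qed.

Lemma regular_atM (y z : K) :
  regular_at x0 y -> regular_at x0 z -> regular_at x0 (y * z).
Proof.
case/regular_atP=> a [s [s0 ->]] /regular_atP[b [t [t0 ->]]]; apply/regular_atP.
exists (a * b), (s * t); rewrite !rmorphM mulf_neq0 //; split=> //.
by rewrite mulf_div.
Qed.

Lemma value_atB (y z : K) : regular_at x0 y -> regular_at x0 z ->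
  value_at x0 (y - z) = value_at x0 y - value_at x0 z.
Proof.
case/regular_atP=> a [s [s0 ->]] /regular_atP[b [t [t0 ->]]].
rewrite -mulNr addf_div ?tofrac_neq0 // -rmorphN -!rmorphM -rmorphD /=.
rewrite !value_atE ?rmorphM ?mulf_neq0 // rmorphD !rmorphM rmorphN /=.
by rewrite -[X in _ = _ + X]mulNr addf_div.
Qed.

Lemma value_at0 : value_at x0 0 = 0.
Proof.
by rewrite -[X in value_at _ X](rmorph0 (@tofrac A)) value_at_tofrac rmorph0.
Qed.

Lemma value_at1 : value_at x0 1 = 1.
Proof.
by rewrite -[X in value_at _ X](rmorph1 (@tofrac A)) value_at_tofrac rmorph1.
Qed.

Lemma coef_specialize (f : {poly K}) j : (specialize x0 f)`_j = value_at x0 f`_j.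
Proof. by rewrite coef_map_id0 // value_at0. Qed.

Lemma monic_specialize (f : {poly K}) : f \is monic -> specialize x0 f \is monic.
Proof.
move=> f_mon; have v1 : value_at x0 (lead_coef f) != 0.
  by rewrite (monicP f_mon) value_at1 oner_neq0.
by rewrite monicE /lead_coef size_map_poly_id0 // coef_specialize
   -/(lead_coef f) (monicP f_mon) value_at1.
Qed.

Lemma local_ring_type : exists (O : comNzRingType) (v : {rmorphism O -> K}),
  injective v /\ forall z, regular_at x0 z <-> exists d, v d = z.
Proof.
apply: subring_type regular_atB regular_atM.
by rewrite -(rmorph1 (@tofrac A)); apply: regular_at_tofrac.
Qed.

(** Gives access to the closure of integral elements under difference and product, which is stated
    for [integralOver]. *)
Lemma integral_overP (O : comNzRingType) (v : {rmorphism O -> K}) :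
    injective v -> (forall z, regular_at x0 z <-> exists d, v d = z) ->
  forall (E : fieldExtType K) (y : E),
    integral_over (regular_at x0) y <-> integralOver (in_alg E \o v) y.
Proof.
move=> v_inj vP E y; split=> [[p [p_mon regp py]]|[p p_mon py]].
  have [|q pE] := @poly_lift _ _ v p.
    by move=> j; case/vP: (regp j) => d; exists d.
  exists q; last by rewrite map_poly_comp -pE.
  have lc : v (lead_coef q) = 1.
    by rewrite -lead_coef_map_inj ?rmorph0 -?pE ?(monicP p_mon).
  by apply/eqP/v_inj; rewrite lc rmorph1.
exists (map_poly v p); split; first exact: monic_map.
  by move=> j; apply/vP; exists p`_j; rewrite coef_map.
by rewrite -map_poly_comp.
Qed.

Variable E : splittingFieldType K.
Implicit Type L : {subfield E}.

Lemma integral_closureB L (y z : E) : integral_closure x0 L y ->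
  integral_closure x0 L z -> integral_closure x0 L (y - z).
Proof.
have [O [v [v_inj vP]]] := local_ring_type.
case=> [yL /(integral_overP v_inj vP) yO] [zL /(integral_overP v_inj vP) zO].
split; first exact: rpredB.
by apply/(integral_overP v_inj vP)/integral_sub.
Qed.

Lemma integral_closureM L (y z : E) : integral_closure x0 L y ->
  integral_closure x0 L z -> integral_closure x0 L (y * z).
Proof.
have [O [v [v_inj vP]]] := local_ring_type.
case=> [yL /(integral_overP v_inj vP) yO] [zL /(integral_overP v_inj vP) zO].
split; first exact: rpredM.
by apply/(integral_overP v_inj vP)/integral_mul.
Qed.

Lemma integral_closure_alg L (z : K) :
  regular_at x0 z -> integral_closure x0 L z%:A.
Proof.
have [O [v [v_inj vP]]] := local_ring_type.
move=> /vP[d <-]; split; first by rewrite rpredZ ?rpred1.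
apply/(integral_overP v_inj vP); exact: (integral_id (in_alg E \o v)).
Qed.

Lemma integral_closure_root L (f : {poly K}) y :
    f \is monic -> (forall j, regular_at x0 f`_j) -> y \in roots_in L f ->
  integral_closure x0 L y.
Proof. by move=> f_mon f_reg /andP[yL fy]; split=> //; exists f. Qed.

Lemma integral_closure_gal L (s : gal_of L) y :
  integral_closure x0 L y -> integral_closure x0 L (s y).
Proof.
case=> yL [p [p_mon regp py]]; split; first exact: memv_gal.
exists p; split=> //; move/(rmorph_root s): py; congr (root _ _).
apply/polyP => j; rewrite !coef_map /=.
by rewrite linearZ /= rmorph1.
Qed.

(** Regularity at [x0] is membership in the local ring at the prime ideal ker [x0], to which
    normality applies. The integral equation descends from [E] to K because [in_alg E] is
    injective. *)
Lemma regular_integral_closure L (z : K) : normal_variety A ->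
  integral_closure x0 L z%:A -> regular_at x0 z.
Proof.
move=> normA [_ [p [p_mon regp pz]]].
apply: normA.
- split; rewrite ?inE ?rmorph0 ?eqxx ?rmorph1 ?oner_neq0 // => a u w /eqP u0 /eqP w0.
  by rewrite inE rmorphD rmorphM u0 w0 mulr0 addr0.
- by move=> u w; rewrite !inE rmorphM mulf_eq0.
exists p; split=> //; rewrite map_poly_id; first by rewrite -(fmorph_root (in_alg E)).
by move=> a _; rewrite /= /GRing.scale /= mulr1.
Qed.

(** [D] is the integral closure as a ring, [k] is its quotient by [M], and [cD] embeds the
    constants. In the last clause, [z] minus the constant [value_at x0 z] vanishes at [x0], hence
    lies in [M]. *)
Lemma residue_field_ex L (c : {rmorphism F -> A}) (M : E -> Prop) :
    cancel c x0 -> maximal_over_point x0 L M ->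
  exists (D : comNzRingType) (v : {rmorphism D -> E}) (k : fieldType)
         (red : {rmorphism D -> k}) (cD : {rmorphism F -> D}),
    [/\ injective v,
        forall y, integral_closure x0 L y <-> exists d, v d = y,
        forall d, red d = 0 <-> M (v d)
      & forall d z, v d = z%:A -> regular_at x0 z ->
          red d = red (cD (value_at x0 z))].
Proof.
move=> cK [[[M_S M0 MD MM] M1 M_max] M_over].
have S1 : integral_closure x0 L 1.
  have := integral_closure_alg L (regular_at_tofrac 1).
  by rewrite rmorph1 scale1r.
have [D [v [v_inj vP]]] :=
  subring_type S1 (@integral_closureB L) (@integral_closureM L).
have Sv d : integral_closure x0 L (v d) by apply/vP; exists d.
have MN y : M y -> M (- y).
  move=> My; rewrite -mulN1r; apply: MM => //.
  by rewrite -(rmorph1 v) -rmorphN; apply: Sv.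
pose b : {pred D} := fun d =>
  if excluded_middle_informative (M (v d)) then true else false.
have bP d : reflect (M (v d)) (d \in b).
  by rewrite unfold_in; case: excluded_middle_informative => ?; constructor.
have b_ideal : idealr_closed b.
  split; first by apply/bP; rewrite rmorph0.
    by apply/bP; rewrite rmorph1.
  move=> a x y /bP Mx /bP My; apply/bP; rewrite rmorphD rmorphM.
  by apply: MD => //; apply: MM.
pose I : idealr D := HB.pack_for (idealr D) b (isIdealr.Build D b b_ideal).
have inv_mod y : y \notin I -> exists u, u * y - 1 \in I.
  move=> /bP nMy; apply: NNPP => no_u; apply: nMy.
  (* [J] is the ideal generated by [y] and [M]. Without an inverse of [y] modulo [M] it is proper,
     and maximality puts [y] in [M]. *)
  pose J z := exists u w : D, M (v w) /\ z = v (u * y + w).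
  apply: (M_max J).
  - split.
    + by move=> _ [u [w [_ ->]]].
    + by exists 0, 0; rewrite !rmorph0 mul0r addr0 rmorph0.
    + move=> _ _ [u [w [Mw ->]]] [u' [w' [Mw' ->]]]; exists (u + u'), (w + w').
      split; first by rewrite rmorphD; apply: MD.
      by rewrite -rmorphD mulrDl addrACA.
    + move=> _ _ /vP[a <-] [u [w [Mw ->]]]; exists (a * u), (a * w).
      split; first by rewrite rmorphM; apply: MM.
      by rewrite -rmorphM mulrDr mulrA.
  - by move=> z Mz; have /vP[w wE] := M_S z Mz; exists 0, w; rewrite mul0r add0r wE.
  - move=> [u [w [Mw e]]]; apply: no_u; exists u; apply/bP.
    have -> : u * y - 1 = - w.
      by apply: v_inj; rewrite rmorphB rmorph1 e -rmorphB opprD addrA subrr sub0r.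
    by rewrite rmorphN; apply: MN.
  - by exists 1, 0; rewrite !rmorph0 mul1r addr0.
have [k [red redP]] := quotient_field inv_mod.
have redM d : red d = 0 <-> M (v d).
  by split=> [/eqP|/bP dI]; [rewrite redP => /bP | apply/eqP; rewrite redP].
pose h : {rmorphism F -> E} := in_alg E \o @tofrac A \o c.
have [cD cDE] : exists cD : {rmorphism F -> D}, forall a, v (cD a) = h a.
  apply: lift_rmorphism => // a; apply/vP.
  exact/integral_closure_alg/regular_at_tofrac.
exists D, v, k, red, cD; split=> // d z dz z_reg.
apply/eqP; rewrite -subr_eq0 -rmorphB; apply/eqP/redM.
rewrite rmorphB /= dz cDE /h /= -scalerBl; apply/M_over.
  exact/regular_atB/regular_at_tofrac.
by rewrite value_atB ?value_at_tofrac ?cK ?subrr //; apply: regular_at_tofrac.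
Qed.

End LocalRing.

(** * Existence of a Frobenius element *)

Lemma gal1_mem (K : fieldType) (E : splittingFieldType K) (L : {subfield E})
    (s : gal_of L) :
  s \in 'Gal(L / 1)%g.
Proof. by rewrite gal_kHom ?sub1v // k1AHom. Qed.

Section FrobeniusExistence.

Variables (F : finFieldType) (A : idomainType) (x0 : {rmorphism A -> F}).
Variables (c : {rmorphism F -> A}) (E : splittingFieldType {fraction A}).
Variables (L : {subfield E}) (M : E -> Prop).
Hypothesis (cK : cancel c x0) (normA : normal_variety A).
Hypothesis (galL : galois 1 L) (M_over : maximal_over_point x0 L M).

Lemma Frobenius_ex : exists s : gal_of L,
  forall a, integral_closure x0 L a -> M (s a - a ^+ #|F|).
Proof.
have [D [v [k [red [cD [v_inj vP redM red_reg]]]]]] := residue_field_ex cK M_over.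
have Sv d : integral_closure x0 L (v d) by apply/vP; exists d.
have vL d : v d \in L by case: (Sv d).
pose j : {rmorphism F -> k} := red \o cD.
have act_ex (s : gal_of L) : exists a : {rmorphism D -> D}, forall d, v (a d) = s (v d).
  apply: (@lift_rmorphism _ _ _ v ((s : 'AEnd(E)) \o v) v_inj) => d.
  exact/vP/integral_closure_gal/Sv.
pose act s := proj1_sig (constructive_indefinite_description _ (act_ex s)).
have actE s d : v (act s d) = s (v d).
  by rewrite /act; case: constructive_indefinite_description.
suff [s sP]: exists s, forall d, red (act s d) = frobenius_power j (red d).
  exists s => _ /vP[d <-]; rewrite -actE -rmorphXn -rmorphB; apply/redM.
  by rewrite rmorphB rmorphXn /= sP subrr.
apply: NNPP => no_s.
have bad_ex s : exists d, red (act s d) <> frobenius_power j (red d).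
  apply: NNPP => no_d; apply: no_s; exists s => d; apply: NNPP => dP.
  by apply: no_d; exists d.
pose bad s := proj1_sig (constructive_indefinite_description _ (bad_ex s)).
have badP s : red (act s (bad s)) <> frobenius_power j (red (bad s)).
  by rewrite /bad; case: constructive_indefinite_description.
(* A single polynomial carries a counterexample for every [s], placed at the index of [s] in the
   enumeration. *)
pose a : {poly D} := Poly (map bad (enum {: gal_of L})).
have aE s : a`_(index s (enum {: gal_of L})) = bad s.
  by rewrite coef_Poly (nth_map s) ?nth_index ?index_mem ?mem_enum.
(* The outer variable is the one in which the conjugates of [a] are the roots; the inner one is the
   variable of [a]. *)
pose P : {poly {poly D}} := \prod_s ('X - (map_poly (act s) a)%:P).
have P_inv t : map_poly (map_poly (act t)) P = P.
  rewrite rmorph_prod /= [RHS](reindex_inj (mulIg t)) /=; apply: eq_bigr => s _.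
  rewrite rmorphB /= map_polyX map_polyC /=; congr (_ - _%:P).
  by apply/polyP => i; rewrite !coef_map /=; apply: v_inj; rewrite !actE galM ?vL.
(* Invariance puts the coefficient in K, integrality with normality makes it regular at [x0], and so
   it reduces to its value in [F]. *)
have P_coef i l : exists b, red P`_i`_l = j b.
  have fix_e t : act t P`_i`_l = P`_i`_l by rewrite -[in RHS](P_inv t) !coef_map.
  have /galois_fixedField fixL := galL.
  have : v P`_i`_l \in fixedField 'Gal(L / 1)%g.
    by apply/fixedFieldP => // t _; rewrite -actE fix_e.
  rewrite fixL => /vlineP[z ez]; exists (value_at x0 z); apply: red_reg => //.
  apply: (regular_integral_closure normA (L := L)); rewrite -ez; exact: Sv.
pose Pbar := map_poly (map_poly red) P.
have PbarE : Pbar =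
    \prod_(p <- [seq map_poly red (map_poly (act s) a) | s : gal_of L]) ('X - p%:P).
  rewrite /Pbar rmorph_prod big_map big_enum /=; apply: eq_bigr => s _.
  by rewrite rmorphB /= map_polyX map_polyC.
have: root Pbar (map_poly red a).
  rewrite PbarE root_prod_XsubC; apply/mapP; exists 1%g; rewrite ?mem_enum //.
  congr map_poly; apply/polyP => i; rewrite coef_map /=; apply: v_inj.
  by rewrite actE gal_id.
(* The coefficients of [Pbar] come from [F], so Frobenius sends the root [map_poly red a] to another
   root, the reduction of some conjugate [s(a)]. The coefficient at the index of [s] then
   contradicts [badP]. *)
move/(rmorph_root (map_poly (frobenius_power j))).
have -> : map_poly (map_poly (frobenius_power j)) Pbar = Pbar.
  apply/polyP => i; apply/polyP => l; rewrite !coef_map /=.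
  by have [b ->] := P_coef i l; rewrite frobenius_power_rmorph.
rewrite PbarE root_prod_XsubC => /mapP[s _ /polyP/(_ (index s (enum {: gal_of L})))].
by rewrite !coef_map aE /= => /esym/badP.
Qed.

End FrobeniusExistence.

(** * Galois group of a compositum *)

Section Compositum.

Variables (K : fieldType) (E : splittingFieldType K) (m : nat).
Variable L_ : 'I_m -> {subfield E}.

Lemma sub_compositum i : (L_ i <= compositum L_)%VS.
Proof. exact/(subv_trans _ (sub_agenv _))/sumv_sup. Qed.

Lemma compositum_sub (W : {subfield E}) :
  (forall i, L_ i <= W)%VS -> (compositum L_ <= W)%VS.
Proof.
move=> sLW; rewrite -(subfield_closed W); apply/agenvS/subv_sumP => i _.
exact: sLW.
Qed.

(** Separability holds because the compositum lies in the field generated by one separable generator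
    of each [L_ i]. Normality holds because automorphisms over K preserve each [L_ i], hence their
    sum and what it generates. *)
Lemma galois_compositum : (forall i, galois 1 (L_ i)) -> galois 1 (compositum L_).
Proof.
move=> galL; rewrite /galois sub1v /=; apply/andP; split.
  pose rs := [seq separable_generator 1 (L_ i) | i : 'I_m].
  apply: (@separableSr _ _ 1 _ <<1 & rs>>%AS).
    apply: compositum_sub => i; have /and3P[_ sepL _] := galL i.
    rewrite (eq_adjoin_separable_generator sepL) ?sub1v //.
    apply/FadjoinP; split; first exact: sub1v.
    apply: seqv_sub_adjoin; exact: image_f.
  apply/separable_Fadjoin_seq/allP => _ /imageP[i _ ->].
  exact: separable_generatorP.
apply/forall_inP => x xK; rewrite /compositum /= aimg_agen limg_sum.
apply/eqP; congr agenv; apply: eq_bigr => i _.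
by have /and3P[_ _ /forall_inP/(_ x xK)/eqP] := galL i.
Qed.

(** The fixed space of [s * t^-1] is a subfield containing every [L_ i], hence the compositum. *)
Lemma gal_eq_compositum (s t : gal_of (compositum L_)) :
  (forall i, {in L_ i, s =1 t}) -> s = t.
Proof.
move=> st; apply/eqP/gal_eqP => y yL.
have: y \in fixedSpace (s * t^-1)%g.
  apply: (subvP _ _ yL); apply: compositum_sub => i; apply/subvP => z zLi.
  have zL : z \in compositum L_ := subvP (sub_compositum i) z zLi.
  rewrite /= -[_ \in _]/(_ \in fixedSpace _); apply/fixedSpaceP.
  by rewrite galM // (st i) // -galM // mulgV gal_id.
by move/fixedSpaceP => e; rewrite -[in RHS]e -galM // mulgKV.
Qed.

(** The products of basis vectors of the [L_ i] are free: they are the images under the injective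
    [g] of pure tensors for which dual functionals exist. *)
Lemma linearly_disjoint_dim :
  linearly_disjoint L_ -> (\prod_i \dim (L_ i) <= \dim (compositum L_))%N.
Proof.
case=> T [tau [g [[_ tau_univ] g_tau g_inj _]]].
pose J := {dffun forall i, 'I_(\dim (L_ i))}.
pose x (p : J) i : subvs_of (L_ i) := vsproj (L_ i) (vbasis (L_ i))`_(p i).
have xE p i : vsval (x p i) = (vbasis (L_ i))`_(p i).
  by rewrite vsprojK // vbasis_mem // mem_nth // size_tuple.
(* The functional dual to [q] is induced by the multilinear map multiplying the [q i]-th
   coordinates, which on basis vectors is a product of Kronecker deltas. *)
have h_ex (q : J) : exists h : {linear T -> K^o}, forall p, h (tau (x p)) = (p == q)%:R.
  pose mu (y : forall i, subvs_of (L_ i)) : K^o :=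
    \prod_i coord (vbasis (L_ i)) (q i) (vsval (y i)).
  have mu_lin : multilinear (W := fun i => subvs_of (L_ i) : lmodType K) mu.
    move=> y i a u v.
    pose rest : K := \prod_(j | j != i) coord (vbasis (L_ j)) (q j) (vsval (y j)).
    have muE (w : subvs_of (L_ i)) : mu (dfwith y w) =
        coord (vbasis (L_ i)) (q i) (vsval w) * rest.
      rewrite /mu (bigD1 i) //; congr (_ * _).
        by rewrite dfwith_in.
      apply: eq_bigr => j ji; rewrite eq_sym in ji.
      by rewrite dfwith_out.
    by rewrite !muE !linearP mulrDl /GRing.scale /= mulrA.
  have [[h hE] _] := tau_univ _ mu mu_lin.
  exists h => p; rewrite hE /mu; have [->|pq] := eqVneq p q.
    by apply: big1 => i _; rewrite xE coord_free ?eqxx // (basis_free (vbasisP _)).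
  have [i pqi]: exists i, p i != q i.
    apply/existsP; apply: contraNT pq => /existsPn pq.
    by apply/eqP/ffunP => i; apply/eqP; rewrite -[_ == _]negbK pq.
  rewrite (bigD1 i) //= xE coord_free ?(basis_free (vbasisP _)) //.
  by rewrite (negPf pqi) mul0r.
pose b (p : J) : E := \prod_i (vbasis (L_ i))`_(p i).
have bE p : b p = g (tau (x p)) by rewrite g_tau; apply: eq_bigr => i _; rewrite xE.
pose X := [tuple b (enum_val i) | i < #|J|].
have free_X : free X.
  apply/freeP => k k0 i0.
  have [h hE] := h_ex (enum_val i0).
  have: \sum_(i < #|J|) k i *: tau (x (enum_val i)) = 0.
    apply: g_inj; rewrite linear_sum linear0 -[RHS]k0; apply: eq_bigr => i _.
    by rewrite linearZ /= -bE (nth_map i0) ?size_enum_ord // nth_ord_enum.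
  move/(congr1 h); rewrite linear_sum linear0 (bigD1 i0) //= linearZ hE /= eqxx.
  rewrite big1 ?addr0 => [|i ii0]; first by rewrite /GRing.scale /= mulr1.
  by rewrite linearZ hE /= (inj_eq enum_val_inj) (negPf ii0) scaler0.
have -> : (\prod_i \dim (L_ i))%N = #|J|.
  rewrite -cardsT; have -> : [set: J] = setXn (fun i => [set: 'I_(\dim (L_ i))]).
    by apply/setP => p; rewrite inE; apply/esym/setXnP => i; rewrite inE.
  by rewrite cardsXn; apply: eq_bigr => i _; rewrite cardsT card_ord.
rewrite -[#|J|](size_tuple X) -(eqP free_X); apply/dimvS/span_subvP.
move=> _ /mapP[i _ ->]; apply: rpred_prod => l _.
apply: (subvP (sub_compositum l)); rewrite vbasis_mem // mem_nth // size_tuple //.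
Qed.

Definition gal_restrict (s : gal_of (compositum L_)) :
  {dffun forall i, gal_of (L_ i)} := [ffun i => gal (L_ i) s].

Hypothesis galL : forall i, galois 1 (L_ i).

(** Normality of [L_ i] over K makes [s] map [L_ i] onto itself, so that [gal (L_ i) s] is a genuine
    restriction. *)
Lemma gal_restrictE s i : {in L_ i, gal_restrict s i =1 s}.
Proof.
rewrite ffunE; apply: galK; have /and3P[_ _ nL] := galL i.
have /forall_inP/(_ (s : 'AEnd(E))) := nL.
by rewrite inE kAutfE k1AHom => /(_ isT)/eqP ->.
Qed.

Lemma gal_restrict_misom : linearly_disjoint L_ ->
  misom 'Gal(compositum L_ / 1)%g (setXn (fun i => 'Gal(L_ i / 1)%g)) gal_restrict.
Proof.
move=> disj.
have resM : {in 'Gal(compositum L_ / 1)%g &, {morph gal_restrict : s t / (s * t)%g}}.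
  move=> s t _ _; apply/ffunP => i; rewrite [RHS]ffunE; apply/eqP/gal_eqP => y yLi.
  have yL := subvP (sub_compositum i) y yLi.
  rewrite galM // !gal_restrictE ?memv_gal //; first by rewrite galM.
  by rewrite -(gal_restrictE s yLi) memv_gal.
have morph_res : morphic 'Gal(compositum L_ / 1)%g gal_restrict by apply/morphicP.
apply/misomP; exists morph_res; apply/isomP.
have inj : ('injm (morphm morph_res))%g.
  apply/injmP => s t _ _ /= st; apply: gal_eq_compositum => i y yLi.
  by rewrite -(gal_restrictE s yLi) [gal_restrict s]st gal_restrictE.
split=> //; apply/eqP; rewrite eqEcard card_injm // cardsXn; apply/andP; split.
  apply/subsetP => _ /morphimP[s _ _ ->]; apply/setXnP => i.
  exact: gal1_mem.
(* Group orders equal degrees over K, so the dimension bound shows that the injective image fills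
   the product. *)
rewrite -galois_dim ?galois_compositum // dimv1 divn1.
apply: leq_trans (linearly_disjoint_dim disj); apply: leq_prod => i _.
by rewrite -galois_dim ?galL // dimv1 divn1.
Qed.

End Compositum.

(** * Reduction modulo a maximal ideal *)

Section Reduction.

Variables (F : finFieldType) (Fbar : closedFieldType) (iota : {rmorphism F -> Fbar}).
Variables (A : idomainType) (x0 : {rmorphism A -> F}) (c : {rmorphism F -> A}).
Variables (E : splittingFieldType {fraction A}) (L : {subfield E}) (M : E -> Prop).
Hypotheses (cK : cancel c x0) (M_over : maximal_over_point x0 L M).
Variable s : gal_of L.
Hypothesis sP : forall a, integral_closure x0 L a -> M (s a - a ^+ #|F|).

(** Replaces the abstract residue field by [Fbar], keeping [M] as the kernel; [N] is kept because it
    expresses inverses modulo [M] as powers. *)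
Lemma reduction_ex : exists (D : comNzRingType) (v : {rmorphism D -> E})
    (red : {rmorphism D -> Fbar}) (N : nat),
  [/\ injective v,
      forall y, integral_closure x0 L y <-> exists d, v d = y,
      forall d, red d = 0 <-> M (v d),
      forall d z, v d = z%:A -> regular_at x0 z -> red d = iota (value_at x0 z)
    & (1 < N)%N /\ forall d, red d ^+ N = red d].
Proof.
have [D [v [k [red [cD [v_inj vP redM red_reg]]]]]] := residue_field_ex cK M_over.
have Sv d : integral_closure x0 L (v d) by apply/vP; exists d.
have vL d : v d \in L by case: (Sv d).
(* By the congruence, [n] applications of [s] raise the reduction to the power q^n. Taking [n] to be
   the order of [s] gives the exponent [N]. *)
have orbit n d : exists d', v d' = (s ^+ n)%g (v d) /\ red d' = red d ^+ (#|F| ^ n).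
  elim: n => [|n [d' [d'E rd']]]; first by exists d; rewrite gal_id expr1.
  have /vP[d'' d''E] := integral_closure_gal s (Sv d').
  exists d''; split; first by rewrite d''E d'E -galM // expgSr.
  rewrite expnSr exprM -rd'; apply/eqP; rewrite -subr_eq0 -rmorphXn -rmorphB.
  by apply/eqP/redM; rewrite rmorphB rmorphXn /= d''E; apply: sP.
pose N := (#|F| ^ #[s]%g)%N.
have N_gt1 : (1 < N)%N.
  by rewrite -(exp1n #[s]%g) ltn_exp2r ?order_gt0 // finNzRing_gt1.
have redN d : red d ^+ N = red d.
  have [d' [d'E <-]] := orbit #[s]%g d; congr (red _).
  by apply: v_inj; rewrite d'E expg_order gal_id.
have closed (p : {poly Fbar}) : size p != 1 -> exists x, root p x.
  by move/closed_rootP.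
have [red' [red'0 red'c]] := residue_embedding iota cD closed N_gt1 redN.
exists D, v, red', N; split=> //.
- move=> d; rewrite -redM; split=> /eqP; first by rewrite red'0 => /eqP.
  by rewrite -red'0 => /eqP.
- move=> d z dz z_reg; rewrite -red'c; apply/eqP; rewrite -subr_eq0 -rmorphB red'0.
  by rewrite rmorphB subr_eq0; apply/eqP/red_reg.
- split=> // d; apply/eqP; rewrite -subr_eq0 -rmorphXn -rmorphB red'0.
  by rewrite rmorphB rmorphXn /= redN subrr.
Qed.

Lemma integral_closureS (L' : {subfield E}) y : (L' <= L)%VS ->
  integral_closure x0 L' y -> integral_closure x0 L y.
Proof. by move=> sL [yL y_int]; split=> //; apply: (subvP sL). Qed.

(* The residue field is finite, so y outside M is invertible mod M by one of
   its own powers, which lies in L' when y does. *)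
Lemma maximal_over_pointS (L' : {subfield E}) : (L' <= L)%VS ->
  maximal_over_point x0 L' (fun y => M y /\ y \in L').
Proof.
move=> sL; have [D [v [red [N [v_inj vP redM _ [N_gt1 redN]]]]]] := reduction_ex.
have [[[M_S M0 MD MM] M1 M_max] M_val] := M_over.
have S_sub y := @integral_closureS L' y sL.
split; last first.
  move=> z z_reg; rewrite -M_val //; split=> [[] //|Mz]; split=> //.
  by rewrite rpredZ ?rpred1.
split; last 1 first.
- move=> J [J_S J0 JD JM] sMJ nJ1 y Jy; have yS := J_S y Jy.
  split; last by case: yS.
  apply: NNPP => nMy; apply: nJ1.
  have /vP[d dy] := S_sub _ yS.
  have SX n : integral_closure x0 L' (y ^+ n).
    elim: n => [|n IHn]; last by rewrite exprS; apply: integral_closureM.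
    have := integral_closure_alg L' (regular_at_tofrac x0 1).
    by rewrite rmorph1 scale1r.
  have J1 : J (1 - y ^+ N.-1).
    apply: sMJ; split; last by case: yS => yL _; rewrite rpredB ?rpredX ?rpred1.
    rewrite -dy -rmorphXn -(rmorph1 v) -rmorphB; apply/redM.
    have rd0 : red d != 0 by apply/eqP => /redM; rewrite dy.
    apply: (mulfI rd0); rewrite mulr0 rmorphB rmorph1 rmorphXn /= mulrBr mulr1.
    by rewrite -exprS prednK ?redN ?subrr // (ltn_trans _ N_gt1).
  rewrite -(subrK (y ^+ N.-1) 1); apply: JD => //.
  (* Since [1 < N], the exponent [N.-1] is positive and a factor [y] in [J] can be split off. *)
  have -> : N.-1 = N.-2.+1 by rewrite prednK // -ltnS prednK // (ltn_trans _ N_gt1).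
  by rewrite exprSr; apply: JM.
- split=> [y [/M_S [_ y_int] yL]||y z [My yL] [Mz zL]|y z yS [Mz zL]].
  + by split.
  + by split=> //; rewrite rpred0.
  + by split; [exact: MD|exact: rpredD].
  + by split; [apply: MM => //; exact: S_sub|case: yS => yL _; exact: rpredM].
- by case.
Qed.

End Reduction.

(** * Roots of a polynomial and of its specialization *)

Lemma galois_splitting (K : fieldType) (E : splittingFieldType K)
    (L : {subfield E}) (f : {poly K}) :
    separable_poly f -> splittingFieldFor 1%VS (map_poly (in_alg E) f) L ->
  galois 1 L.
Proof.
move=> sep_f split_f; apply/splitting_galoisField.
exists (map_poly (in_alg E) f); split=> //; last by rewrite separable_map.
exact: alg_polyOver.
Qed.

(** The roots of [f] are integral, so [f] splits over [D] and its factorization can be reduced. One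
    list [ds] thus gives the roots of [f] through [v] and those of the specialization through
    [red]. *)
Lemma root_reduction (F : finFieldType) (Fbar : closedFieldType)
    (iota : {rmorphism F -> Fbar}) (A : idomainType) (x0 : {rmorphism A -> F})
    (E : splittingFieldType {fraction A}) (L L' : {subfield E})
    (D : comNzRingType) (v : {rmorphism D -> E}) (red : {rmorphism D -> Fbar})
    (f : {poly {fraction A}}) :
    injective v -> (forall y, integral_closure x0 L y -> exists d, v d = y) ->
    (forall d z, v d = z%:A -> regular_at x0 z -> red d = iota (value_at x0 z)) ->
    (L' <= L)%VS -> f \is monic -> (forall j, regular_at x0 f`_j) ->
    splittingFieldFor 1%VS (map_poly (in_alg E) f) L' ->
    distinct_roots iota (specialize x0 f) ->
  exists ds : seq D,
    [/\ uniq (map red ds), roots_in L' f =i map v ds, <<1 & map v ds>>%VS = L'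
      & map_poly iota (specialize x0 f) = \prod_(r <- map red ds) ('X - r%:P)].
Proof.
move=> v_inj vP red_reg sL f_mon f_reg [rs f_rs gen_rs] [rs' urs' f_rs'].
have {}f_rs : map_poly (in_alg E) f = \prod_(r <- rs) ('X - r%:P).
  by apply/eqP; rewrite -eqp_monic ?monic_prod_XsubC ?map_monic.
have rsP : roots_in L' f =i rs.
  move=> y; rewrite inE f_rs root_prod_XsubC andb_idl // -gen_rs => yrs.
  exact: seqv_sub_adjoin.
have int_rs y : y \in rs -> integral_closure x0 L y.
  by rewrite -rsP => yR; apply: integral_closureS sL _; apply: integral_closure_root yR.
have [ds rsE] : exists ds, rs = map v ds.
  elim: rs {f_rs gen_rs rsP} int_rs => [|y rs IHrs] int_rs; first by exists [::].
  have [|ds ->] := IHrs; first by move=> z zrs; apply: int_rs; rewrite inE zrs orbT.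
  by have [|d <-] := vP y (int_rs y _); [rewrite inE eqxx|exists (d :: ds)].
have [fD fDE] : exists fD, map_poly (in_alg E) f = map_poly v fD.
  apply: poly_lift => j; rewrite coef_map /=.
  by have [d <-] := vP _ (integral_closure_alg L (f_reg j)); exists d.
have fD_ds : fD = \prod_(d <- ds) ('X - d%:P).
  apply: (map_inj_poly v_inj (rmorph0 v)); rewrite -fDE f_rs rsE big_map rmorph_prod.
  by apply: eq_bigr => d _; rewrite rmorphB /= map_polyX map_polyC.
have f_red : map_poly iota (specialize x0 f) = \prod_(r <- map red ds) ('X - r%:P).
  rewrite big_map; transitivity (map_poly red fD); last first.
    rewrite fD_ds rmorph_prod; apply: eq_bigr => d _.
    by rewrite rmorphB /= map_polyX map_polyC.
  apply/polyP => j; rewrite !coef_map /= coef_specialize; apply/esym/red_reg => //.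
  by rewrite -[LHS]coef_map -fDE coef_map.
exists ds; rewrite -rsE; split=> //.
(* The duplicate-free [rs'] lists the roots of the same monic polynomial, so it is a permutation of
   the reduced roots. *)
rewrite (perm_uniq (s2 := rs')) //; apply: prod_XsubC_eq; rewrite -f_red f_rs'.
by rewrite (monicP (monic_specialize x0 f_mon)) rmorph1 scale1r.
Qed.

(** * Frobenius elements, actions on roots and splitting types *)

Theorem theorem4p3
  (F : finFieldType)
  (Fbar : closedFieldType) (iota : {rmorphism F -> Fbar})
  (Fbar_algebraic : integralRange iota)
  (A : idomainType) (c : {rmorphism F -> A})
  (X_variety : affine_geom_integral c) (X_normal : normal_variety A)
  (x0 : {rmorphism A -> F}) (x0_rational : cancel c x0)
  (E : splittingFieldType {fraction A})
  (m : nat) (f : 'I_m -> {poly {fraction A}}) (L_ : 'I_m -> {subfield E})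
  (f_monic : forall i, f i \is monic)
  (f_separable : forall i, separable_poly (f i))
  (f_regular : forall i j, regular_at x0 (f i)`_j)
  (L_splitting : forall i,
     splittingFieldFor 1%VS (map_poly (in_alg E) (f i)) (L_ i))
  (L_disjoint : linearly_disjoint L_)
  (f_distinct : forall i, distinct_roots iota (specialize x0 (f i)))
  (M : E -> Prop) (M_over : maximal_over_point x0 (compositum L_) M) :
  exists (Frob : gal_of (compositum L_)) (Frob_ : forall i, gal_of (L_ i)),
    [/\ is_Frobenius x0 M Frob,
        forall i, is_Frobenius x0 (fun y => M y /\ y \in L_ i) (Frob_ i),
        isomorphic_actions
          (fun x : {ffun 'I_m -> E} => forall i, x i \in roots_in (L_ i) (f i))
          (fun x => [ffun i => Frob (x i)])
          (fun y : {ffun 'I_m -> Fbar} =>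
             forall i, root (map_poly iota (specialize x0 (f i))) (y i))
          (fun y => [ffun i => y i ^+ #|F|]),
        exists res : gal_of (compositum L_) -> {dffun forall i, gal_of (L_ i)},
          [/\ misom 'Gal(compositum L_ / 1)%g
                    (setXn (fun i => 'Gal(L_ i / 1)%g)) res,
              forall s i, {in L_ i, res s i =1 s}
            & res Frob = [ffun i => Frob_ i]]
      & forall i ds, splitting_type (specialize x0 (f i)) ds
                     <-> cycle_type (Frob_ i) (roots_in (L_ i) (f i)) ds].
Proof.
have galL i : galois 1 (L_ i) := galois_splitting (f_separable i) (L_splitting i).
have gal_comp := galois_compositum galL.
have [Frob FrobP] := Frobenius_ex x0_rational X_normal gal_comp M_over.
have [D [v [red [N [v_inj vP redM red_reg [N_gt1 redN]]]]]] :=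
  reduction_ex iota x0_rational M_over FrobP.
have [[[M_S M0 MD MM] M1 M_max] M_val] := M_over.
(* Taking the components to be restrictions of [Frob] makes the product formula hold by
   construction; what remains is that they are Frobenius elements. *)
pose FrobL i : gal_of (L_ i) := gal_restrict Frob i.
have ds_ex i := root_reduction v_inj (fun y => (vP y).1) red_reg
  (sub_compositum L_ i) (f_monic i) (f_regular i) (L_splitting i) (f_distinct i).
(* [rho] is reduction modulo [M] made total on [E]. Its value is meaningful on the range of [v],
   where injectivity of [v] determines it. *)
pose rho y : Fbar := epsilon (inhabits 0) (fun r => exists2 d, v d = y & r = red d).
have rhoE d : rho (v d) = red d.
  have [|d' /v_inj -> //] := epsilon_spec (inhabits 0)
    (fun r => exists2 d', v d' = v d & r = red d').
  by exists (red d), d.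
have MB y z : M y -> M z -> M (y - z).
  move=> My Mz; have [/vP[a ay] /vP[b bz]] := (M_S _ My, M_S _ Mz).
  rewrite -ay -bz -rmorphB; apply/redM; rewrite rmorphB.
  by rewrite !(redM _).2 ?subr0 ?ay ?bz.
have M_congr s t : M (v s - v t) -> red s = red t.
  by rewrite -rmorphB => /redM; rewrite rmorphB => /eqP; rewrite subr_eq0 => /eqP.
have rho_inj i : {in roots_in (L_ i) (f i) &, injective rho}.
  have [ds [uds Rds _ _]] := ds_ex i.
  move=> y z; rewrite !Rds => /mapP[a ads ->] /mapP[b bds ->]; rewrite !rhoE => ab.
  rewrite -[a](nth_index 0 ads) -[b](nth_index 0 bds); congr (v (nth _ _ _)).
  apply/eqP; rewrite -(nth_uniq 0 _ _ uds) ?size_map ?index_mem //.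
  by rewrite !(nth_map 0) ?index_mem // !nth_index // ab.
have gal_root i (s : gal_of (L_ i)) : {homo s : y / y \in roots_in (L_ i) (f i)}.
  move=> y /andP[yL fy]; rewrite inE memv_gal //=.
  move: (rmorph_root s fy); congr (root _ _); apply/polyP => j.
  by rewrite !coef_map /= linearZ /= rmorph1.
have int_root i y : y \in roots_in (L_ i) (f i) -> integral_closure x0 (L_ i) y.
  exact: integral_closure_root.
have int_comp i y :
    integral_closure x0 (L_ i) y -> integral_closure x0 (compositum L_) y.
  exact/integral_closureS/sub_compositum.
have rho_congr y z : integral_closure x0 (compositum L_) y ->
    integral_closure x0 (compositum L_) z -> M (y - z) -> rho y = rho z.
  by move=> /vP[a <-] /vP[b <-] /M_congr; rewrite !rhoE.
(* Congruences on the roots suffice: reduction is injective on them, so [s] and [t] agree on the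
   roots, which generate [L_ i]. *)
have Frob_unique i (s t : gal_of (L_ i)) :
    (forall a, a \in roots_in (L_ i) (f i) -> M (s a - a ^+ #|F|)) ->
    (forall a, a \in roots_in (L_ i) (f i) -> M (t a - a ^+ #|F|)) -> s = t.
  move=> sP tP; have [ds [_ Rds gen_ds _]] := ds_ex i.
  have st : {in map v ds, s =1 t}.
    move=> y; rewrite -Rds => yR; apply: (rho_inj i); [exact: gal_root..|].
    apply: rho_congr; [by apply/int_comp/int_root/gal_root..|].
    by have := MB _ _ (sP y yR) (tP y yR); rewrite opprB addrA subrK.
  have sub_fix : (<<1 & map v ds>> <= fixedSpace (s * t^-1)%g)%VS.
    apply/Fadjoin_seqP; split; first exact: sub1v.
    move=> z zds; apply/fixedSpaceP.
    have zL : z \in L_ i by move: zds; rewrite -Rds => /andP[].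
    by rewrite galM // (st z zds) -galM // mulgV gal_id.
  rewrite gen_ds in sub_fix; apply/eqP/gal_eqP => y yL.
  have /fixedSpaceP e := subvP sub_fix y yL.
  by rewrite -[in RHS]e -galM // mulgKV.
have FrobL_congr i a : integral_closure x0 (L_ i) a ->
    M (FrobL i a - a ^+ #|F|) /\ FrobL i a - a ^+ #|F| \in L_ i.
  move=> a_int; have [aL _] := a_int.
  split; last by rewrite rpredB ?memv_gal ?rpredX.
  by rewrite gal_restrictE //; apply: FrobP; apply: int_comp a_int.
have rho_Frob i y : y \in roots_in (L_ i) (f i) -> rho (FrobL i y) = rho y ^+ #|F|.
  move=> yR; have [d dy] := (vP y).1 (int_comp i y (int_root i y yR)).
  rewrite -dy rhoE -rmorphXn -rhoE; apply: rho_congr; rewrite ?rmorphXn ?dy.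
  - exact/int_comp/int_root/gal_root.
  - by apply/vP; exists (d ^+ #|F|); rewrite rmorphXn dy.
  - by case: (FrobL_congr i y (int_root i y yR)).
have root_rho i r : root (map_poly iota (specialize x0 (f i))) r <->
    exists2 y, y \in roots_in (L_ i) (f i) & r = rho y.
  have [ds [_ Rds _ ->]] := ds_ex i; rewrite root_prod_XsubC.
  split=> [/mapP[d dds ->]|[y]].
    by exists (v d); rewrite ?rhoE // Rds map_f.
  by rewrite Rds => /mapP[d dds ->] ->; rewrite rhoE map_f.
exists Frob, FrobL; split.
- split=> //; first by split=> //; exact: gal1_mem.
  (* Uniqueness is checked on each [L_ i], where the restriction of [t] satisfies the same
     congruences on the roots. *)
  move=> t [_ tP]; apply: (gal_eq_compositum) => i y yL.
  suff tF : gal_restrict t i = gal_restrict Frob i.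
    by rewrite -(gal_restrictE galL t yL) tF gal_restrictE.
  apply: Frob_unique => a /int_root a_int; have [aL _] := a_int.
    by rewrite gal_restrictE //; apply: tP; apply: int_comp a_int.
  by rewrite gal_restrictE //; apply: FrobP; apply: int_comp a_int.
- move=> i; split.
  + exact: (maximal_over_pointS iota x0_rational M_over FrobP (sub_compositum L_ i)).
  + by split; [exact: gal1_mem|exact: FrobL_congr].
  + move=> t [_ tP]; apply: Frob_unique => a /int_root a_int.
      by case: (tP a a_int).
    by case: (FrobL_congr i a a_int).
- exists (fun x => [ffun i => rho (x i)]); split.
  + by move=> x xR i; rewrite ffunE; apply/root_rho; exists (x i).
  + move=> x x' xR x'R /ffunP xx'; apply/ffunP => i; apply: (rho_inj i) => //.
    by have := xx' i; rewrite !ffunE.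
  + move=> y yR.
    have /fin_all_exists[x xP] i : exists z, z \in roots_in (L_ i) (f i) /\ y i = rho z.
      by have [z zR ->] := (root_rho i (y i)).1 (yR i); exists z.
    exists [ffun i => x i]; first by move=> i; rewrite ffunE; case: (xP i).
    by apply/ffunP => i; rewrite !ffunE; case: (xP i).
  + move=> x xR; apply/ffunP => i; rewrite !ffunE.
    rewrite -(rho_Frob i _ (xR i)) gal_restrictE //; by case/andP: (xR i).
- exists (@gal_restrict _ E m L_); split.
  + exact: gal_restrict_misom.
  + exact: gal_restrictE.
  + by apply/ffunP => i; rewrite [RHS]ffunE.
move=> i ds; have [rs [urs Rrs _ rsE]] := ds_ex i.
have memR r : r \in map red rs <-> exists2 y, y \in roots_in (L_ i) (f i) & r = rho y.
  by rewrite -root_rho rsE root_prod_XsubC.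
rewrite (splitting_type_cycle_type _ urs rsE); split.
  (* [inv] inverts [rho] on the roots by position: the index of a reduced root in [map red rs]
     selects its lift in [rs]. The default 0 is not reached on reduced roots. *)
  pose inv r := v (nth 0 rs (index r (map red rs))).
  have invK y : y \in roots_in (L_ i) (f i) -> inv (rho y) = y.
    move=> yR; have yrs : rho y \in map red rs by apply/memR; exists y.
    have lt_rs : (index (rho y) (map red rs) < size rs)%N.
      by rewrite -(size_map red) index_mem.
    apply: (rho_inj i) => //; first by rewrite /inv Rrs map_f // mem_nth.
    by rewrite rhoE -(nth_map 0 0) ?nth_index.
  apply: (cycle_type_map (h := inv)).
  + move=> _ _ /memR[y yR ->] /memR[z zR ->]; rewrite !invK // => -> //.
  + move=> y; split=> [yR|[_ /memR[z zR ->] ->]]; last by rewrite invK.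
    by exists (rho y); [apply/memR; exists y|rewrite invK].
  + move=> _ /memR[y yR ->]; rewrite /frobenius_power -(rho_Frob i y yR) !invK //.
    exact: gal_root.
apply: (cycle_type_map (h := rho)).
- exact: rho_inj.
- exact: memR.
- by move=> y yR; apply: rho_Frob.
Qed.
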